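(* Let $\mathcal{A}$ be a normed algebra, let $\mathcal{B}$ be a closed subalgebra of $\mathcal{A}$, and let $M$ be the quotient norm on $\mathcal{A}/\mathcal{B}$ pulled back to $\mathcal{A}$, i.e. $M(A) = \inf\{\|A-B\| : B \in \mathcal{B}\}$. Let $A \in \mathcal{A}$. If $A$ is same-norm approximatable in $\mathcal{B}$, then for all $C \in \mathcal{A}$ $$M(AC) \leq M(A)\|C\| + \|A\|M(C),$$ and similarly $M(CA) \leq M(C)\|A\| + \|C\|M(A)$.
   Context: The norm of a normed algebra is submultiplicative. Let $\mathcal{A}$ be a normed vector space, $\mathcal{B}$ a closed subspace, and $M(A) = \inf\{\|A-B\| : B \in \mathcal{B}\}$. An element $A \in \mathcal{A}$ is same-norm approximatable in $\mathcal{B}$ if for every $\varepsilon > 0$ there is a $B \in \mathcal{B}$ with $\|B\| \leq \|A\|$ and $\|A-B\| < M(A) + \varepsilon$. *)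

(* Defs.v *)
From HB Require Import structures.
From mathcomp Require Import all_boot all_order all_algebra.
From mathcomp Require Import complex.
From mathcomp Require Import boolp classical_sets reals topology normedtype.

Set Implicit Arguments.
Unset Strict Implicit.
Unset Printing Implicit Defensive.
Import Order.TTheory GRing.Theory Num.Theory numFieldNormedType.Exports.
Local Open Scope classical_set_scope.
Local Open Scope ring_scope.

(* A normed algebra need not have a unit, so it is not built on algType. *)
HB.mixin Record NormedModule_isNormedAlgebra (K : numFieldType) A
    & NormedModule K A := {
  amul : A -> A -> A;
  amulA : associative amul;
  amulDl : left_distributive amul +%R;
  amulDr : right_distributive amul +%R;
  amulZl : forall (k : K) (x y : A), amul (k *: x) y = k *: amul x y;
  amulZr : forall (k : K) (x y : A), amul x (k *: y) = k *: amul x y;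
  normr_amul : forall x y : A, `|amul x y| <= `|x| * `|y|
}.

#[short(type="normedAlgType")]
HB.structure Definition NormedAlgebra (K : numFieldType) :=
  {A of NormedModule K A & NormedModule_isNormedAlgebra K A}.

Notation "x '**' y" := (amul x y) (at level 40, left associativity) : ring_scope.

Definition subalgebra (K : numFieldType) (A : normedAlgType K) (B : set A) :=
  submod_closed [in B] /\ (forall x y, B x -> B y -> B (x ** y)).

(* The library's norm on a normed space over K takes its values in K, also when
   K is the field of complex numbers; there, x <= y implies that x and y have
   the same imaginary part, so that the greatest lower bound in K of a nonempty
   set of norms is its infimum in the reals. *)
Definition quotient_norm (K : numFieldType) (V : normedModType K) (B : set V)
    (a : V) : K :=
  infimum 0 [set `|a - b| | b in B].

Definition same_norm_approximatable (K : numFieldType) (V : normedModType K)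
    (B : set V) (a : V) : Prop :=
  forall e : K, 0 < e ->
    exists b, [/\ B b, `|b| <= `|a| & `|a - b| < quotient_norm B a + e].

Variant scalars := RealScalars | ComplexScalars.

Definition scalar_field (R : realType) (s : scalars) : numFieldType :=
  match s with RealScalars => R | ComplexScalars => R[i] end.

Lemma scalar_field_infimum (R : realType) (s : scalars)
    (E : set (scalar_field R s)) :
  E !=set0 -> (forall x, E x -> 0 <= x) -> infimums E (infimum 0 E).
Proof.
move=> E0 Ege; suff [m Em] : infimums E !=set0.
  rewrite /infimum; case: ifPn => [/eqP E_0|_]; last by apply: xgetPex; exists m.
  by case: E0 => x; rewrite E_0.
case: s E E0 Ege => /= E [x0 Ex0] Ege.
  have hE : has_inf E by split; [exists x0|exists 0 => x /Ege].
  exists (inf E); split; first by move=> x Ex; apply: ge_inf => //; case: hE.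
  by move=> y yE; apply: lb_le_inf => //; exists x0.
pose F := [set r : R | E r%:C%C].
have EF x : E x -> x = (complex.Re x)%:C%C.
  move=> /Ege; case: x => a b; rewrite lecE /= => /andP[/eqP -> _].
  by [].
have F0 : F !=set0 by exists (complex.Re x0); rewrite /F /= -EF.
have hF : has_inf F.
  split => //; exists 0 => r /Ege; by rewrite lecE /= => /andP[].
exists (inf F)%:C%C; split.
  move=> x Ex; rewrite (EF x Ex) lecR; apply: ge_inf; first by case: hF.
  by rewrite /F /= -EF.
move=> [a b] ab.
have b0 : b = 0.
  by have := ab _ Ex0; rewrite (EF _ Ex0) lecE /= => /andP[/eqP <-].
rewrite b0 lecE /= eqxx /=; apply: lb_le_inf => // r Fr.
by have := ab _ Fr; rewrite lecE /= => /andP[].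
Qed.

(* Main.v *)
Require Import Defs.
From HB Require Import structures.
From mathcomp Require Import all_boot all_order all_algebra.
From mathcomp Require Import boolp classical_sets reals topology normedtype.

Set Implicit Arguments.
Unset Strict Implicit.
Unset Printing Implicit Defensive.
Import Order.TTheory GRing.Theory Num.Theory numFieldNormedType.Exports.
Local Open Scope classical_set_scope.
Local Open Scope ring_scope.

(** The proof compares a product [a ** c] with products [b ** d] of elements of
    [B], which stay in [B] because [B] is a subalgebra. The difference telescopes
      a c - b d = (a - b) c + b (c - d),
    so its norm is at most |a - b| |c| + |b| |c - d|. Taking [d] nearly optimal
    for [c] makes |c - d| close to M(c); the factor |b| is the only obstruction,
    and same-norm approximatability of [a] removes it, as it provides [b] nearly
    optimal for [a] with |b| <= |a|. For the product in the other order the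
    identity is c a - d b = (c - d) b + c (a - b), which again leaves |b|, and
    not |d|, as the factor to bound. Letting the error tend to 0 concludes. *)

Lemma le_bilinear_addgt0 (K : numFieldType) (x p q u v : K) :
  0 <= p -> 0 <= q ->
  (forall e, 0 < e -> x <= (u + e) * p + q * (v + e)) -> x <= u * p + q * v.
Proof.
move=> p0 q0 H; apply/ler_addgt0Pr => e e0.
(* The summand 1 keeps the divisor positive when p = q = 0. *)
have s0 : 0 < p + q + 1 by rewrite ltr_wpDl ?addr_ge0.
apply: le_trans (H (e / (p + q + 1)) (divr_gt0 e0 s0)) _.
rewrite mulrDl mulrDr addrACA lerD2l [q * _]mulrC -mulrDr.
by rewrite mulrAC ler_pdivrMr // ler_wpM2l ?(ltW e0) // lerDl.
Qed.

Lemma amulBl (K : numFieldType) (A : normedAlgType K) (x y z : A) :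
  (x - y) ** z = x ** z - y ** z.
Proof. by rewrite amulDl -scaleN1r amulZl scaleN1r. Qed.

Lemma amulBr (K : numFieldType) (A : normedAlgType K) (x y z : A) :
  z ** (x - y) = z ** x - z ** y.
Proof. by rewrite amulDr -scaleN1r amulZr scaleN1r. Qed.

Section QuotientNorm.
Variables (R : realType) (s : scalars).
Variables (V : normedModType (scalar_field R s)) (B : set V).
Hypothesis B0 : B !=set0.

Lemma quotient_norm_infimums (x : V) :
  infimums [set `|x - b| | b in B] (quotient_norm B x).
Proof.
apply: scalar_field_infimum; first by case: B0 => b Bb; exists `|x - b|, b.
by move=> _ [b _ <-].
Qed.

Lemma quotient_norm_le (x b : V) : B b -> quotient_norm B x <= `|x - b|.
Proof. by move=> Bb; apply: (quotient_norm_infimums x).1; exists b. Qed.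

Lemma quotient_norm_ge0 (x : V) : 0 <= quotient_norm B x.
Proof. by apply: (quotient_norm_infimums x).2 => _ [b _ <-]. Qed.

(** If no element of [B] were within M(x) + e of [x], then M(x) + e would be a
    lower bound of the distances larger than the greatest one. Over the complex
    numbers the order is partial, and this reading of the negation uses that all
    the scalars compared are real, being nonnegative. *)
Lemma quotient_norm_approx (x : V) (e : scalar_field R s) : 0 < e ->
  exists2 b, B b & `|x - b| < quotient_norm B x + e.
Proof.
move=> e0; apply: contrapT => nob.
have : quotient_norm B x + e <= quotient_norm B x.
  apply: (quotient_norm_infimums x).2 => _ [b Bb <-].
  rewrite real_leNgt ?ger0_real ?addr_ge0 ?quotient_norm_ge0 ?(ltW e0) //.
  by apply/negP => lt_b; apply: nob; exists b.
by rewrite gerDl lt_geF.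
Qed.

End QuotientNorm.

Theorem proposition2p2 (R : realType) (s : scalars)
  (A : normedAlgType (scalar_field R s)) (B : set A)
  (Bclosed : closed B) (Bsub : subalgebra B) (a : A)
  (ha : same_norm_approximatable B a) :
  let M := quotient_norm B in
  forall c : A,
    M (a ** c) <= M a * `|c| + `|a| * M c /\
    M (c ** a) <= M c * `|a| + `|c| * M a.
Proof.
move=> M c; case: Bsub => -[B0 _] BM.
have {}B0 : B !=set0 by exists 0; move: B0; rewrite inE.
split; apply: le_bilinear_addgt0 => // e e0;
  have [b [Bb ba ab]] := ha e e0; have [d Bd cd] := quotient_norm_approx B0 c e0.
- apply: le_trans (quotient_norm_le B0 _ (BM _ _ Bb Bd)) _.
  have -> : a ** c - b ** d = (a - b) ** c + b ** (c - d).
    by rewrite amulBl amulBr addrA subrK.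
  apply: le_trans (ler_normD _ _) _; apply: lerD;
    apply: le_trans (normr_amul _ _) _; first by rewrite ler_wpM2r // ltW.
  by rewrite ler_pM // ltW.
- apply: le_trans (quotient_norm_le B0 _ (BM _ _ Bd Bb)) _.
  have -> : c ** a - d ** b = (c - d) ** b + c ** (a - b).
    by rewrite amulBl amulBr [RHS]addrC addrA subrK.
  apply: le_trans (ler_normD _ _) _; apply: lerD;
    apply: le_trans (normr_amul _ _) _; last by rewrite ler_wpM2l // ltW.
  by rewrite ler_pM // ltW.
Qed.
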